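(* Let $N\ge1$ be an integer, let $a,c,b_1,\dots,b_N$ be real, let $x_1,\dots,x_N<1$ be real, and put $\beta_1=a-1$, $\beta_2=c-a-1$, $\alpha_i=-b_i$. With the coefficients $d_k,e_k,d_k(p),e_k(p)$ given by the explicit formulas in the context, the following identities hold. (1) If $n\ge0$ is an integer and $c>a>0$, then $$\sum_{k=0}^{N+1}(n\,d_{k+1}+e_k)\,B(a+k+n,c-a)\,F_D^{(N)}(a+k+n;b_1,\dots,b_N;c+k+n;x_1,\dots,x_N)=0 .$$ (2) If $n<0$ is an integer, $c>a>0$, all $x_j\ne0$, $p<1$ is real, $p\neq 0$ and $p\ne x_1,\dots,x_N$, then $$\sum_{k=0}^{N+2}\bigl[-np\,d_k(p)+e_{k-1}(p)\bigr]\,F_D^{(N+1)}(a;b_1,\dots,b_N,1-k-n;c;x_1,\dots,x_N,p)=0 .$$ (3) If $n$ is an integer, $c+n>a>0$, all $x_j\neq 0$ and $p=1$, then $$\sum_{k=0}^{N+1}\bigl(-np\,d_{k+1}(p)+e_k(p)\bigr)\,B(a,c+k+n-a)\,F_D^{(N)}(a;b_1,\dots,b_N;c+n+k;x_1,\dots,x_N)=0 .$$ (4) If $n$ is an integer, $c>a>0$, all $x_j\ne0$ and $p=x_i$ for some $i\in\{1,\dots,N\}$, then $$\sum_{k=0}^{N+1}\bigl(-np\,d_{k+1}(p)+e_k(p)\bigr)\,F_D^{(N)}(a;b_1,\dots,b_i-n-k,\dots,b_N;c;x_1,\dots,x_N)=0 .$$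
   Context: **Lauricella function.** For any number $M\ge1$ of variables, $F_D^{(M)}(a;b_1,\dots,b_M;c;x_1,\dots,x_M)$ denotes the Lauricella function of type $D$: for $|x_i|<1$, $$F_D^{(M)}=\sum_{i_1,\dots,i_M\ge0}\frac{(a)_{i_1+\dots+i_M}(b_1)_{i_1}\cdots(b_M)_{i_M}}{(c)_{i_1+\dots+i_M}\,i_1!\cdots i_M!}x_1^{i_1}\cdots x_M^{i_M},$$ with $(s)_i=s(s+1)\cdots(s+i-1)$ the Pochhammer symbol. For $c>a>0$ and real $x_i<1$ it is given (by analytic continuation) by $$F_D^{(M)}=\frac{1}{B(a,c-a)}\int_0^1t^{a-1}(1-t)^{c-a-1}\prod_{i=1}^M(1-x_it)^{-b_i}\,dt,$$ where $B$ is the Euler beta function. **Symmetric polynomials.** $\sigma_l(y_1,\dots,y_k)$ is the $l$-th elementary symmetric polynomial in $k$ variables, with $\sigma_0=1$ (also for $k=0$) and $\sigma_l=0$ if $l<0$ or $l>k$. **Coefficients in (1).** $$d_k=(-1)^{k-1}[\sigma_{k-1}(x_1,\dots,x_N)+\sigma_{k-2}(x_1,\dots,x_N)],\qquad e_k=(\beta_1+1)v_k+(\beta_2+1)w_k+\sum_{l=1}^N(\alpha_l+1)x_lz_{k,l},$$ $$v_k=(-1)^k[\sigma_k(x_1,\dots,x_N)+\sigma_{k-1}(x_1,\dots,x_N)],\quad w_k=(-1)^k\sigma_{k-1}(x_1,\dots,x_N),$$ $$z_{k,l}=(-1)^k[\sigma_{k-1}((x_i)_{i\ne l})+\sigma_{k-2}((x_i)_{i\ne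 l})].$$ **Coefficients in (2), (3), (4)** (evaluated at the relevant $p$; for $p=1$ or $p=x_i$ the formulas are specialized to that value, where arguments of $\sigma$ equal to zero may be dropped): $$d_k(p)=\frac{x_1\cdots x_N}{p^{N+2}}\left[\sigma_{N+1-k}\Bigl(p-1,\bigl(\tfrac{p-x_j}{x_j}\bigr)_{j=1,\dots,N}\Bigr)-\sigma_{N+2-k}\Bigl(p-1,\bigl(\tfrac{p-x_j}{x_j}\bigr)_{j=1,\dots,N}\Bigr)\right],$$ $$e_k(p)=\frac{x_1\cdots x_N}{p^{N+1}}\left[(\beta_1+1)v_k(p)+(\beta_2+1)w_k(p)+\sum_{l=1}^N(\alpha_l+1)x_l\,z_{k,l}(p)\right],$$ $$v_k(p)=\sigma_{N+1-k}\Bigl(p-1,\bigl(\tfrac{p-x_j}{x_j}\bigr)_{j=1,\dots,N}\Bigr),\quad w_k(p)=\sigma_{N+1-k}\Bigl(-1,\bigl(\tfrac{p-x_j}{x_j}\bigr)_{j=1,\dots,N}\Bigr),$$ $$z_{k,l}(p)=\sigma_{N+1-k}\Bigl(-1,p-1,\bigl(\tfrac{p-x_j}{x_j}\bigr)_{j\ne l}\Bigr).$$ In particular $e_{-1}(p)=0$.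
   Formalization: In e_k(p), used in (2)-(4), the summand is (α_l+1) z_{k,l}(p) without the factor x_l, since with it the identities fail (for example (3) with N=1, a=1, c=2, b=0, x=1/2, n=0 gives 1/24). *)

(* Defs.v *)
From mathcomp Require Import all_boot all_order all_algebra.
From mathcomp Require Import all_classical all_reals all_analysis.

Set Implicit Arguments.
Unset Strict Implicit.
Unset Printing Implicit Defensive.

Import Order.TTheory GRing.Theory Num.Theory.
Local Open Scope classical_set_scope.
Local Open Scope ring_scope.

(* Meaningful for a, b > 0, where the integrand is Lebesgue integrable. *)
Definition eulerBeta (R : realType) (a b : R) : R :=
  \int[@lebesgue_measure R]_(t in `]0, 1[) (t `^ (a - 1) * (1 - t) `^ (b - 1)).

(* The Lauricella function F_D of M variables, for c > a > 0 and real x_i < 1.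
   The hypergeometric series only converges for |x_i| < 1; on the whole range
   x_i < 1 its analytic continuation is Euler's integral. *)
Definition lauricellaFD (R : realType) (M : nat)
    (a : R) (b : M.-tuple R) (c : R) (x : M.-tuple R) : R :=
  (eulerBeta a (c - a))^-1 *
  \int[@lebesgue_measure R]_(t in `]0, 1[)
     (t `^ (a - 1) * (1 - t) `^ (c - a - 1) *
      \prod_(i < M) (1 - tnth x i * t) `^ (- tnth b i)).

(* The l-th elementary symmetric polynomial evaluated at the entries of y.
   The degree l is an integer: the formulas below use negative degrees, for
   which the value is 0. *)
Definition elemsym (R : realType) (l : int) (y : seq R) : R :=
  if l is Posz m then
    \sum_(A : {set 'I_(size y)} | #|A| == m) \prod_(i in A) y`_i
  else 0.

Definition omit (T : Type) (N : nat) (y : N.-tuple T) (l : 'I_N) : seq T :=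
  [seq tnth y j | j <- enum 'I_N & j != l].

(* With u_j = 1 - x_j t, the d_k are the coefficients in the powers of t of
     t (1 - t) \prod_j u_j
   (d_0 = 0), and the e_k those of
     beta1' (1 - t) \prod_j u_j - beta2' t \prod_j u_j
       - \sum_l alpha'_l x_l t (1 - t) \prod_(j <> l) u_j,
   where the prime stands for "+ 1". *)
Definition dcoef (R : realType) (N : nat) (x : N.-tuple R) (k : int) : R :=
  (-1) ^ (k - 1) * (elemsym (k - 1) x + elemsym (k - 2) x).

Definition vcoef (R : realType) (N : nat) (x : N.-tuple R) (k : int) : R :=
  (-1) ^ k * (elemsym k x + elemsym (k - 1) x).

Definition wcoef (R : realType) (N : nat) (x : N.-tuple R) (k : int) : R :=
  (-1) ^ k * elemsym (k - 1) x.

Definition zcoef (R : realType) (N : nat) (x : N.-tuple R)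
    (k : int) (l : 'I_N) : R :=
  (-1) ^ k * (elemsym (k - 1) (omit x l) + elemsym (k - 2) (omit x l)).

Definition ecoef (R : realType) (N : nat) (beta1 beta2 : R)
    (alpha x : N.-tuple R) (k : int) : R :=
  (beta1 + 1) * vcoef x k + (beta2 + 1) * wcoef x k +
  \sum_(l < N) (tnth alpha l + 1) * tnth x l * zcoef x k l.

(* The same two polynomials, expanded in the powers of s = 1 - p t instead. *)
Definition shifted (R : realType) (N : nat) (x : N.-tuple R) (p : R) :
    N.-tuple R :=
  [tuple (p - tnth x j) / tnth x j | j < N].

Definition dcoefp (R : realType) (N : nat) (x : N.-tuple R)
    (p : R) (k : int) : R :=
  (\prod_(j < N) tnth x j) / p ^+ (N + 2) *
  (elemsym (N%:Z + 1 - k) ((p - 1) :: shifted x p) -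
   elemsym (N%:Z + 2 - k) ((p - 1) :: shifted x p)).

Definition vcoefp (R : realType) (N : nat) (x : N.-tuple R)
    (p : R) (k : int) : R :=
  elemsym (N%:Z + 1 - k) ((p - 1) :: shifted x p).

Definition wcoefp (R : realType) (N : nat) (x : N.-tuple R)
    (p : R) (k : int) : R :=
  elemsym (N%:Z + 1 - k) (-1 :: shifted x p).

Definition zcoefp (R : realType) (N : nat) (x : N.-tuple R)
    (p : R) (k : int) (l : 'I_N) : R :=
  elemsym (N%:Z + 1 - k) [:: -1, p - 1 & omit (shifted x p) l].

(* Unlike in ecoef, the l-th summand carries no separate factor x_l: since
   u_j = (x_j / p) (s + (p - x_j) / x_j), the product
   x_l t (1 - t) \prod_(j <> l) u_j already contributes x_l \prod_(j <> l) x_j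
   to the common factor \prod_j x_j. (A formula with a further factor x_l
   would make the contiguity relations false.) *)
Definition ecoefp (R : realType) (N : nat) (beta1 beta2 : R)
    (alpha x : N.-tuple R) (p : R) (k : int) : R :=
  (\prod_(j < N) tnth x j) / p ^+ (N + 1) *
  ((beta1 + 1) * vcoefp x p k + (beta2 + 1) * wcoefp x p k +
   \sum_(l < N) (tnth alpha l + 1) * zcoefp x p k l).

(* Main.v *)
Require Import Defs.
From mathcomp Require Import all_boot all_order all_algebra.
From mathcomp Require Import all_classical all_reals all_analysis.
From mathcomp Require Import measurable_realfun zify ring lra.

Set Implicit Arguments.
Unset Strict Implicit.
Unset Printing Implicit Defensive.

Import Order.TTheory GRing.Theory Num.Theory.
Import numFieldNormedType.Exports.
Local Open Scope classical_set_scope.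
Local Open Scope ring_scope.

(** All four relations say that the integral over ]0, 1[ of a derivative is
    zero, provided that the primitive vanishes at both ends.  Let

      w(t) = t^(a-1) (1-t)^(b-1) prod_i u_i^(r_i),      u_i = 1 - x_i t,

    be the integrand of Euler's formula (eulerKernel), with a, b > 0.  With the
    polynomial P = t (1-t) prod_i u_i one has (P w)' = Q w for the polynomial

      Q = a (1-t) prod_i u_i - b t prod_i u_i
            - sum_l (r_l + 1) x_l t (1-t) prod_(j <> l) u_j

    (pearsonP, pearsonQ; this is Pearson's differential equation for the weight
    w), and P w is again a kernel, with a, b and all r_i raised by one, so it
    vanishes at 0 and 1.  Hence the integral of Q w is zero.  If Q is expanded
    in the powers of a linear form s that is t, 1 - t, some u_i or a new factor
    1 - p t, then each s^k w is itself an Euler kernel with one exponent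
    raised by k, and the vanishing of the integral becomes a linear relation
    between contiguous Lauricella functions (eulerKernel_contiguity).

    In the statement a relation depends on an integer n because w is first
    multiplied by a power of s: by t^n, (1 - p t)^(n-1), (1-t)^n and u_i^n in
    the four relations.  The product is again a kernel, and its polynomial is
    Q + n s' P / s, except in the second relation, where it is s Q + n s' P.
    This is where the combinations of d_k (the coefficients of P) and e_k
    (those of Q) come from.  Outside the second relation s divides P, so that
    d_0 = 0 and the sum over d_k may be shifted by one.

    The kernel is unbounded at the ends when a < 1 or b < 1, so the fundamental
    theorem of calculus is needed on an open interval
    (integral_derivative_open).  Integrability comes from

      t^(a-1) (1-t)^(b-1) = t^a (1-t)^(b-1) + (1-t)^b t^(a-1)
                          <= (1-t)^(b-1) + t^(a-1),

    whose right side has the bounded primitive t^a / a - (1-t)^b / b.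

    The algebraic half, the identification of d_k and e_k as expansion
    coefficients, rests on the generating function of the elementary symmetric
    polynomials (prod_linear_elemsym), read once in the powers of t and once in
    the powers of 1 - p t. *)

(** * Integrals of derivatives over an open interval *)

Lemma is_derive1_continuous (R : realType) (f : R -> R) (t d : R) :
  is_derive t 1 f d -> {for t, continuous f}.
Proof.
move=> [fd _]; exact/differentiable_continuous/derivable1_diffP.
Qed.

(** On the compact intervals [a + e_n, b - e_n] the integral of f is a
    difference of two values of F, hence at most 2 M; since f >= 0, monotone
    convergence carries the bound over to ]a, b[. *)
Lemma integrable_of_bounded_primitive (R : realType) (f F : R -> R)
    (a b M : R) :
  a < b ->
  (forall t, t \in `]a, b[ -> 0 <= f t) ->
  (forall t, t \in `]a, b[ -> {for t, continuous f}) ->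
  (forall t, t \in `]a, b[ -> is_derive t 1 F (f t)) ->
  (forall t, t \in `]a, b[ -> `|F t| <= M) ->
  (@lebesgue_measure R).-integrable `]a, b[ (EFin \o f).
Proof.
move=> ab f0 cf dF FM.
pose e n : R := (b - a) / n.+3%:R.
have ba : 0 < b - a by rewrite subr_gt0.
have e0 n : 0 < e n by rewrite divr_gt0.
have e3 n : e n <= (b - a) / 3.
  by rewrite ler_pM2l// lef_pV2 ?posrE// ler_nat.
pose I n : set R := `[a + e n, b - e n]%classic.
have subI n t : t \in `[a + e n, b - e n] -> t \in `]a, b[.
  rewrite !in_itv/= => /andP[t1 t2]; apply/andP; split.
    by rewrite (lt_le_trans _ t1)// ltrDl.
  by rewrite (le_lt_trans t2)// ltrBlDr ltrDl.
have lt_I n : a + e n < b - e n.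
  by have := e3 n; have := e0 n; lra.
have mf : measurable_fun `]a, b[ f.
  apply: open_continuous_measurable_fun.
    exact: interval_open.
  by move=> t; rewrite inE => /cf.
have bigI : `]a, b[%classic = \bigcup_n I n.
  apply/seteqP; split => [t /=|t [n _] /=]; last exact: subI.
  rewrite in_itv/= => /andP[at_ tb].
  pose m := Num.min (t - a) (b - t).
  have m0 : 0 < m by rewrite /m lt_min !subr_gt0 at_.
  exists (Num.truncn ((b - a) / m)) => //=.
  have em : e (Num.truncn ((b - a) / m)) <= m.
    rewrite ler_pdivrMr// mulrC -ler_pdivrMr//.
    apply: (le_trans (ltW (truncnS_gt _))).
    by rewrite ler_nat (leq_trans (leqnSn _)).
  have mt : m <= t - a by rewrite ge_min lexx.
  have mb : m <= b - t by rewrite ge_min lexx orbT.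
  by rewrite /I/= in_itv/= -lerBrDl (le_trans em)//= lerBrDr -lerBrDl (le_trans em).
have subIab n : I n `<=` `]a, b[ by move=> t /= /subI.
apply/integrableP; split; first exact/measurable_EFinP.
under eq_integral => t.
  rewrite inE => /= tab; rewrite ger0_norm ?f0 //.
  over.
have cvgI : (\int[@lebesgue_measure R]_(x in I i) (f x)%:E @[i --> \oo] -->
    \int[@lebesgue_measure R]_(x in `]a, b[) (f x)%:E)%E.
  rewrite bigI; apply: ge0_nondecreasing_set_cvg_integral.
  - apply/nondecreasing_seqP => n; rewrite subsetEset => t /=.
    have : e n.+1 <= e n by rewrite ler_pM2l// lef_pV2 ?posrE// ler_nat.
    rewrite /I/= !in_itv/= => en /andP[t1 t2]; apply/andP; split; lra.
  - by move=> n; exact: measurable_itv.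
  - by move=> n; apply/measurable_EFinP; exact: measurable_funS mf.
  - by move=> n t /subIab tI; rewrite lee_fin f0.
have -> : (\int[@lebesgue_measure R]_(x in `]a, b[) (f x)%:E =
   limn (fun i => \int[@lebesgue_measure R]_(x in I i) (f x)%:E))%E.
  exact/esym/cvg_lim.
apply: (@le_lt_trans _ _ ((M + M)%:E)); last exact: ltry.
apply: lime_le; first by apply/cvg_ex; eexists; exact: cvgI.
apply: nearW => n.
rewrite (@continuous_FTC2 _ f F)//.
- rewrite -EFinB lee_fin; apply: le_trans (ler_norm _) _.
  apply: le_trans (ler_normB _ _) _; apply: lerD; apply/FM/(subI n).
    by rewrite in_itv/= lexx ltW.
  by rewrite in_itv/= lexx ltW.
- by apply: continuous_in_subspaceT => t; rewrite inE => /subI/cf.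
- have cF t : t \in `[a + e n, b - e n] -> {for t, continuous F}.
    by move=> /subI/dF; exact: is_derive1_continuous.
  split.
  + move=> t /subset_itv_oo_cc /subI /dF dFt; exact: ex_derive.
  + by apply/cvg_at_right_filter/cF; rewrite in_itv/= lexx ltW.
  + by apply/cvg_at_left_filter/cF; rewrite in_itv/= lexx ltW.
- move=> t /subset_itv_oo_cc /subI /dF dFt.
  by rewrite derive1E derive_val.
Qed.

(** The function f may be unbounded near a and b, so the fundamental theorem on
    [a, b] does not apply to it.  But t |-> \int_a^t f is continuous on [a, b]
    by integrability alone and has derivative f inside, so that its difference
    with F is constant by the mean value theorem. *)
Lemma integral_derivative_open (R : realType) (f F : R -> R) (a b : R) :
  a < b ->
  (forall t, t \in `]a, b[ -> {for t, continuous f}) ->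
  (@lebesgue_measure R).-integrable `]a, b[ (EFin \o f) ->
  (forall t, t \in `]a, b[ -> is_derive t 1 F (f t)) ->
  {within `[a, b], continuous F} ->
  \int[@lebesgue_measure R]_(t in `]a, b[) f t = F b - F a.
Proof.
move=> ab cf intf dF cF.
(* Extending f by zero avoids any use of its values at a and b. *)
pose g := f \_ `]a, b[.
have intg : (@lebesgue_measure R).-integrable `[a, b] (EFin \o g).
  apply: (@integrableS _ _ _ _ setT) => //.
  have := (@integrable_mkcond _ _ R (@lebesgue_measure R) _ (EFin \o f)
    (measurable_itv _)).1 intf.
  by rewrite restrict_EFin.
have gE t : t \in `]a, b[ -> g t = f t by move=> tab; rewrite /g patchE mem_set.
have cg t : t \in `]a, b[ -> {for t, continuous g}.
  move=> tab; rewrite /prop_for/continuous_at gE//.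
  have tn : \near t, `]a, b[%classic t.
    by apply: open_nbhs_nbhs; split; [exact: interval_open|].
  apply: cvg_trans (cf t tab); apply: near_eq_cvg.
  by near=> u; rewrite gE//; near: u; exact: tn.
pose G t := \int[@lebesgue_measure R]_(u in `[a, t]) g u.
have cG : {within `[a, b], continuous G}.
  exact: parameterized_integral_continuous (ltW ab) intg.
have dG t : t \in `]a, b[ -> is_derive t 1 G (f t).
  move=> tab; have /andP[at_ tb] : a < t < b by rewrite in_itv in tab.
  have [dGt Gt] := continuous_FTC1_closed tb intg at_ (cg t tab).
  by split=> //; rewrite -derive1E Gt gE.
have [c _] : exists2 c, c \in `]a, b[ & (G \- F) b - (G \- F) a = 0 * (b - a).
  apply: (@MVT R (G \- F) (fun=> 0) a b ab).
    move=> t tab; have dGt := dG t tab; have dFt := dF t tab.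
    by rewrite -(subrr (f t)); exact: is_deriveB.
  by move=> t; apply: continuousB; [exact: cG | exact: cF].
rewrite mul0r /= => eqGF.
have Ga : G a = 0 by rewrite /G set_itv1 Rintegral_set1.
have -> : \int[@lebesgue_measure R]_(t in `]a, b[) f t = G b.
  rewrite /G /g -Rintegral_mkcondr setIidr//; exact: subset_itv_oo_cc.
by lra.
Unshelve. all: by end_near. Qed.

(** * The Euler kernel and its derivative *)

Definition eulerKernel (R : realType) (M : nat) (a b : R) (x r : 'I_M -> R)
    (t : R) : R :=
  t `^ (a - 1) * (1 - t) `^ (b - 1) * \prod_(i < M) (1 - x i * t) `^ r i.

Lemma linear_factor_gt0 (R : realType) (x t : R) :
  x < 1 -> 0 <= t <= 1 -> 0 < 1 - x * t.
Proof.
move=> x1 /andP[]; rewrite le_eqVlt => /predU1P[<-|t0] t1; first by lra.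
have : 0 < (1 - x) * t by rewrite mulr_gt0// subr_gt0.
by lra.
Qed.

Lemma powR_pred (R : realType) (u e : R) : 0 < u -> u `^ (e - 1) = u `^ e / u.
Proof. by move=> u0; rewrite powRB ?powRr1 ?ltW// (gt_eqF u0) implybT. Qed.

(** Each derivative is given as f_i g_i, that is, g_i is the logarithmic
    derivative; these just add up, while no f_i has to be invertible. *)
Lemma is_derive_prod (R : realType) (M : nat) (f : 'I_M -> R -> R)
    (g : 'I_M -> R) (t : R) :
  (forall i, is_derive t 1 (f i) (f i t * g i)) ->
  is_derive t 1 (fun u => \prod_(i < M) f i u)
    ((\prod_(i < M) f i t) * \sum_(i < M) g i).
Proof.
elim: M f g => [|M IH] f g df.
  rewrite (_ : (fun _ => _) = cst 1); last first.
    by apply/funext => u; rewrite big_ord0.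
  by rewrite !big_ord0 mulr0; exact: is_derive_cst.
have := IH (fun i => f (widen_ord (leqnSn M) i))
  (fun i => g (widen_ord (leqnSn M) i)) (fun i => df _).
set F := fun u => _ => dF; have := is_deriveM dF (df ord_max).
have -> : F * f ord_max = fun u => \prod_(i < M.+1) f i u.
  by apply/funext => u; rewrite big_ord_recr.
move=> h; apply: is_derive_eq h _.
rewrite !big_ord_recr/= /F /GRing.scale/=; ring.
Qed.

Lemma is_derive_powR_linear (R : realType) (x r t : R) : 0 < 1 - x * t ->
  is_derive t 1 (fun u => (1 - x * u) `^ r)
    ((1 - x * t) `^ r * (- (r * x) / (1 - x * t))).
Proof.
move=> xt; have dl : is_derive t 1 (fun u : R => 1 - x * u) (- x).
  have -> : (fun u : R => 1 - x * u) = (cst 1 - x *: (@id R)).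
    by apply/funext.
  by apply: is_derive_eq; rewrite sub0r /GRing.scale/= mulr1.
have := @is_derive1_comp R (fun u => u `^ r) _ t _ _ (is_derive1_powR r xt) dl.
move=> h; apply: is_derive_eq h _.
rewrite powR_pred//.
by field; rewrite gt_eqF.
Qed.

Lemma is_derive_powR_onem (R : realType) (r t : R) : t < 1 ->
  is_derive t 1 (fun u => (1 - u) `^ r) (- (r * (1 - t) `^ (r - 1))).
Proof.
move=> t1; have t1' : 0 < 1 - 1 * t by rewrite mul1r subr_gt0.
have := is_derive_powR_linear r t1'.
have -> : (fun u => (1 - 1 * u) `^ r) = (fun u => (1 - u) `^ r).
  by apply/funext => u; rewrite mul1r.
move=> h; apply: is_derive_eq h _; move: t1'; rewrite mul1r => t1'.
by rewrite powR_pred//; field; rewrite gt_eqF.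
Qed.

Lemma is_derive_linear_product (R : realType) (M : nat) (x r : 'I_M -> R)
    (t : R) :
  (forall i, x i < 1) -> 0 <= t <= 1 ->
  is_derive t 1 (fun u => \prod_(i < M) (1 - x i * u) `^ r i)
    ((\prod_(i < M) (1 - x i * t) `^ r i) *
     \sum_(i < M) - (r i * x i) / (1 - x i * t)).
Proof.
move=> x1 t01; apply: is_derive_prod => i; apply: is_derive_powR_linear.
exact: linear_factor_gt0.
Qed.

Lemma is_derive_eulerKernel (R : realType) (M : nat) (a b : R)
    (x r : 'I_M -> R) (t : R) :
  (forall i, x i < 1) -> t \in `]0, 1[ ->
  is_derive t 1 (eulerKernel a b x r)
    (eulerKernel a b x r t *
     ((a - 1) / t - (b - 1) / (1 - t) -
      \sum_(i < M) r i * x i / (1 - x i * t))).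
Proof.
move=> x1; rewrite in_itv/= => /andP[t0 t1].
have t01 : 0 <= t <= 1 by rewrite !ltW.
have da := is_derive1_powR (a - 1) t0.
have db := is_derive_powR_onem (b - 1) t1.
have dp := is_derive_linear_product r x1 t01.
have h := is_deriveM (is_deriveM da db) dp.
apply: is_derive_eq h _.
rewrite /GRing.scale/= fctE.
rewrite (powR_pred (a - 1) t0) (@powR_pred _ (1 - t) (b - 1)) ?subr_gt0//.
rewrite /eulerKernel.
have -> : \sum_(i < M) - (r i * x i) / (1 - x i * t) =
    - \sum_(i < M) r i * x i / (1 - x i * t).
  by rewrite -sumrN; apply: eq_bigr => i _; rewrite mulNr.
set S := \sum_(i < M) _; set P := \prod_(i < M) _.
by field; rewrite subr_eq0 !gt_eqF.
Qed.

Lemma eulerKernel_gt0 (R : realType) (M : nat) (a b : R)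
    (x r : 'I_M -> R) (t : R) :
  (forall i, x i < 1) -> t \in `]0, 1[ -> 0 < eulerKernel a b x r t.
Proof.
move=> x1; rewrite in_itv/= => /andP[t0 t1].
rewrite !mulr_gt0 ?powR_gt0 ?subr_gt0//.
by apply: prodr_gt0 => i _; rewrite powR_gt0// linear_factor_gt0// !ltW.
Qed.

(** * Integrability of the Euler kernel *)

Lemma powR_unit_le1 (R : realType) (u e : R) :
  0 <= u <= 1 -> 0 <= e -> u `^ e <= 1.
Proof.
move=> /andP[u0 u1] e0; have -> : 1 = 1 `^ e :> R by rewrite powR1.
by apply: ge0_ler_powR; rewrite // nnegrE.
Qed.

Lemma integrable_endpoint_powers (R : realType) (a b : R) : 0 < a -> 0 < b ->
  (@lebesgue_measure R).-integrable `]0, 1[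
    (EFin \o (fun t => t `^ (a - 1) + (1 - t) `^ (b - 1))).
Proof.
move=> a0 b0.
have e0 : forall i : 'I_0, (fun=> 0 : R) i < 1 by [].
apply: (@integrable_of_bounded_primitive R _
  (fun t => a^-1 * t `^ a - b^-1 * (1 - t) `^ b) _ _ (a^-1 + b^-1)) => //.
- by move=> t _; rewrite addr_ge0 ?powR_ge0.
- move=> t; rewrite in_itv/= => /andP[t0 t1].
  have dt := is_derive1_powR (a - 1) t0.
  have dt' := is_derive_powR_onem (b - 1) t1.
  exact: is_derive1_continuous (is_deriveD dt dt').
- move=> t; rewrite in_itv/= => /andP[t0 t1].
  have dt := is_deriveZ a^-1 (is_derive1_powR a t0).
  have dt' := is_deriveZ b^-1 (is_derive_powR_onem b t1).
  have h := is_deriveB dt dt'.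
  apply: is_derive_eq h _; rewrite /GRing.scale/=.
  by field; rewrite !gt_eqF.
- have bound (u e : R) : 0 < e -> 0 < u < 1 -> `|e^-1 * u `^ e| <= e^-1.
    move=> e0' /andP[u0 u1]; have ie0 : 0 <= e^-1 by rewrite invr_ge0 ltW.
    rewrite ger0_norm; last by rewrite mulr_ge0// powR_ge0.
    by rewrite ler_piMr// powR_unit_le1//; [apply/andP; split|]; exact: ltW.
  move=> t; rewrite in_itv/= => /andP[t0 t1].
  apply: le_trans (ler_normB _ _) _; apply: lerD; apply: bound => //.
    by rewrite t0.
  by rewrite subr_gt0 t1 gtrBl.
Qed.

(** The product is continuous on the compact interval [0, 1], because x_i < 1
    keeps every factor positive there, also at t = 1. *)
Lemma linear_product_le (R : realType) (M : nat) (x r : 'I_M -> R) :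
  (forall i, x i < 1) ->
  exists C, forall t, 0 <= t <= 1 -> \prod_(i < M) (1 - x i * t) `^ r i <= C.
Proof.
move=> x1.
have [|c _ hc] :=
    @EVT_max R (fun t => \prod_(i < M) (1 - x i * t) `^ r i) 0 1 ler01.
  apply: continuous_in_subspaceT => t; rewrite inE/= in_itv/= => t01.
  exact: is_derive1_continuous (is_derive_linear_product r x1 t01).
by exists (\prod_(i < M) (1 - x i * c) `^ r i) => t t01; apply: hc; rewrite in_itv.
Qed.

Lemma integrable_eulerKernel (R : realType) (M : nat) (a b : R)
    (x r : 'I_M -> R) : (forall i, x i < 1) -> 0 < a -> 0 < b ->
  (@lebesgue_measure R).-integrable `]0, 1[ (EFin \o eulerKernel a b x r).
Proof.
move=> x1 a0 b0; have [C hC] := linear_product_le r x1.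
have mk : measurable_fun (`]0, 1[ : set R) (eulerKernel a b x r).
  apply: open_continuous_measurable_fun; first exact: interval_open.
  move=> t; rewrite inE => /= t01.
  exact: is_derive1_continuous (is_derive_eulerKernel a b r x1 t01).
pose g (t : R) : R := t `^ (a - 1) + (1 - t) `^ (b - 1).
apply: (@le_integrable _ _ R (@lebesgue_measure R) _ (measurable_itv _) _
  (fun t => C%:E * (EFin \o g) t)%E).
- exact/measurable_EFinP.
- move=> t /= t01; rewrite lee_fin; have k0 := eulerKernel_gt0 a b r x1 t01.
  rewrite (gtr0_norm k0); apply: le_trans (ler_norm _).
  move: t01; rewrite in_itv/= => /andP[t0 t1].
  have t01 : 0 <= t <= 1 by rewrite !ltW.
  have u0 : 0 < 1 - t by rewrite subr_gt0.
  have u1 : 1 - t <= 1 by rewrite gerBl ltW.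
  rewrite mulrC; apply: ler_pM => //.
  + by rewrite mulr_ge0 ?powR_ge0.
  + by apply: prodr_ge0 => i _; exact: powR_ge0.
  (* Inserting 1 = t + (1 - t) separates the two singularities. *)
  + have -> : t `^ (a - 1) * (1 - t) `^ (b - 1) =
      t `^ a * (1 - t) `^ (b - 1) + (1 - t) `^ b * t `^ (a - 1).
      by rewrite !powR_pred//; field; rewrite !gt_eqF.
    rewrite addrC; apply: lerD; rewrite ler_piMl ?powR_ge0//.
      by rewrite powR_unit_le1 ?(ltW u0) ?(ltW b0).
    by rewrite powR_unit_le1 ?(ltW a0).
  + exact: hC.
- by apply: integrableZl => //; exact: integrable_endpoint_powers.
Qed.

Lemma eulerBeta_eulerKernel (R : realType) (a b : R) :
  eulerBeta a b = \int[@lebesgue_measure R]_(t in `]0, 1[)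
    eulerKernel a b (fun _ : 'I_0 => 0) (fun=> 0) t.
Proof.
by apply: eq_Rintegral => t _; rewrite /eulerKernel big_ord0 mulr1.
Qed.

(** If the integral were zero, then f would vanish almost everywhere on D, and
    D would be a null set. *)
Lemma Rintegral_positive_neq0 (d : measure_display) (T : measurableType d)
    (R : realType) (mu : {measure set T -> \bar R}) (D : set T) (f : T -> R) :
  measurable D -> mu D != 0%E -> mu.-integrable D (EFin \o f) ->
  (forall t, D t -> 0 < f t) -> \int[mu]_(t in D) f t != 0.
Proof.
move=> mD D0 fi f0; apply: contra D0 => /eqP int0.
have mf : measurable_fun D (EFin \o f) by case/integrableP: fi.
have /(ae_eq_integral_abs _ mD mf)[Z [mZ Z0 sZ]] :
    (\int[mu]_(t in D) `|(EFin \o f) t| = 0)%E.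
  transitivity (\int[mu]_(t in D) (f t)%:E)%E.
    by apply: eq_integral => t; rewrite inE => /f0 ft /=; rewrite gtr0_norm.
  by rewrite -(fineK (integrable_fin_num mD fi)) -[fine _]/(Rintegral _ _ _) int0.
rewrite -measure_le0 -Z0; apply: le_measure; rewrite ?inE// => t Dt.
by apply: sZ => /(_ Dt)[] ft; have := f0 _ Dt; rewrite ft ltxx.
Qed.

(** The beta function is a denominator in lauricellaFD, where 0^-1 = 0; its
    products with lauricellaFD are the plain integrals only if it is not 0. *)
Lemma eulerBeta_neq0 (R : realType) (a b : R) : 0 < a -> 0 < b ->
  eulerBeta a b != 0.
Proof.
move=> a0 b0; rewrite eulerBeta_eulerKernel.
have x1 : forall i : 'I_0, (fun _ : 'I_0 => 0 : R) i < 1 by [].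
apply: Rintegral_positive_neq0.
- exact: measurable_itv.
- have := lebesgue_measure_itv (`]0, 1[ : interval R).
  rewrite /= => ->; rewrite lte_fin ltr01 sube0 eqe; exact: oner_neq0.
- exact: integrable_eulerKernel.
- by move=> t; exact: eulerKernel_gt0.
Qed.

(** * Pearson's equation and the contiguity principle *)

Lemma cvg_one_minus (R : realType) :
  (1 - t : R) @[t --> (1 : R)^'-] --> (0 : R)^'+.
Proof.
move=> A /= [d d0 dA]; exists d => // t /= td t1; apply: dA.
  by rewrite /= sub0r normrN.
by rewrite /= subr_gt0.
Qed.

(** For exponents a - 1, b - 1 > 0 the powers tend to 0 at the ends, which is
    also their value there as 0 `^ e = 0 for e != 0.  Continuity holds within
    [0, 1] only: u `^ e = 1 for u < 0. *)
Lemma within_continuous_eulerKernel (R : realType) (M : nat) (a b : R)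
    (x r : 'I_M -> R) : (forall i, x i < 1) -> 1 < a -> 1 < b ->
  {within `[0, 1], continuous (eulerKernel a b x r)}.
Proof.
move=> x1 a1 b1; pose p (t : R) : R := \prod_(i < M) (1 - x i * t) `^ r i.
have cp t : 0 <= t <= 1 -> {for t, continuous p}.
  by move=> t01; exact: is_derive1_continuous (is_derive_linear_product r x1 t01).
have kE t : eulerKernel a b x r t = t `^ (a - 1) * (1 - t) `^ (b - 1) * p t by [].
have a0 : 0 < a - 1 by rewrite subr_gt0.
have b0 : 0 < b - 1 by rewrite subr_gt0.
apply/continuous_within_itvP => //; split.
- move=> t t01.
  exact: is_derive1_continuous (is_derive_eulerKernel a b r x1 t01).
- rewrite kE powR0 ?gt_eqF// !mul0r -[X in _ --> X](mul0r (p 0)).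
  apply: cvgM; last by apply: cvg_at_right_filter; apply: cp; rewrite lexx ler01.
  rewrite -[X in _ --> X](mul0r ((1 - 0) `^ (b - 1))); apply: cvgM.
    exact: powR_cvg0.
  apply: cvg_at_right_filter.
  exact: is_derive1_continuous (is_derive_powR_onem (b - 1) ltr01).
- rewrite kE subrr powR0 ?gt_eqF// mulr0 mul0r -[X in _ --> X](mul0r (p 1)).
  apply: cvgM; last by apply: cvg_at_left_filter; apply: cp; rewrite lexx ler01.
  rewrite -[X in _ --> X](mulr0 (1 `^ (a - 1))); apply: cvgM.
    apply: cvg_at_left_filter.
    exact: is_derive1_continuous (is_derive1_powR (a - 1) ltr01).
  exact: cvg_comp (@cvg_one_minus R) (powR_cvg0 b0).
Qed.

(** The polynomial P of Pearson's equation: as a product of all the bases, it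
    raises every exponent of the kernel by one. *)
Definition pearsonP (R : realType) (M : nat) (x : 'I_M -> R) (t : R) : R :=
  t * (1 - t) * \prod_(i < M) (1 - x i * t).

(** The polynomial Q in (P w)' = Q w for the Euler kernel w with parameters a,
    b, x, r and P = pearsonP x. *)
Definition pearsonQ (R : realType) (M : nat) (a b : R) (x r : 'I_M -> R)
    (t : R) : R :=
  a * ((1 - t) * \prod_(i < M) (1 - x i * t)) -
  b * (t * \prod_(i < M) (1 - x i * t)) -
  \sum_(l < M) (r l + 1) * x l *
    (t * (1 - t) * \prod_(j < M | j != l) (1 - x j * t)).

Lemma eulerKernel_pearsonP (R : realType) (M : nat) (a b : R)
    (x r : 'I_M -> R) (t : R) : (forall i, x i < 1) -> t \in `]0, 1[ ->
  eulerKernel (a + 1) (b + 1) x (fun i => r i + 1) t =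
  eulerKernel a b x r t * pearsonP x t.
Proof.
move=> x1; rewrite in_itv/= => /andP[t0 t1].
have t1' : 0 < 1 - t by rewrite subr_gt0.
rewrite /eulerKernel /pearsonP !addrK (powR_pred a t0) (powR_pred b t1').
under eq_bigr => i _.
  rewrite powRD; last by rewrite (gt_eqF (linear_factor_gt0 _ _)) ?implybT ?x1 ?ltW.
  rewrite powRr1; last by rewrite ltW// linear_factor_gt0 ?x1 ?ltW.
  over.
by rewrite big_split/=; field; rewrite !gt_eqF.
Qed.

(** The last factor on the left is the logarithmic derivative of P w; each of
    its denominators is one of the factors of P. *)
Lemma pearsonP_logder (R : realType) (M : nat) (a b : R)
    (x r : 'I_M -> R) (t : R) : (forall i, x i < 1) -> t \in `]0, 1[ ->
  pearsonP x t * (a / t - b / (1 - t) -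
      \sum_(i < M) (r i + 1) * x i / (1 - x i * t)) = pearsonQ a b x r t.
Proof.
move=> x1; rewrite in_itv/= => /andP[t0 t1].
have t1' : 0 < 1 - t by rewrite subr_gt0.
rewrite /pearsonQ mulrBr mulr_sumr; congr (_ - _).
  by rewrite /pearsonP; field; rewrite !gt_eqF.
apply: eq_bigr => i _; rewrite /pearsonP (bigD1 i)//=.
by field; rewrite gt_eqF// linear_factor_gt0 ?x1 ?ltW.
Qed.


Lemma Rintegral_sum (d : measure_display) (T : measurableType d)
    (R : realType) (mu : {measure set T -> \bar R}) (D : set T) (K : nat)
    (f : 'I_K -> T -> R) :
  measurable D -> (forall k, mu.-integrable D (EFin \o f k)) ->
  mu.-integrable D (EFin \o (fun t => \sum_(k < K) f k t)) /\
  \int[mu]_(t in D) (\sum_(k < K) f k t) =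
  \sum_(k < K) \int[mu]_(t in D) f k t.
Proof.
move=> mD; elim: K f => [|K IH] f fi.
  rewrite (_ : (fun t => _) = cst 0); last first.
    by apply/funext => t; rewrite big_ord0.
  by split; [exact: integrable0|rewrite Rintegral_cst// mul0r big_ord0].
have [gi ige] := IH (fun k => f (widen_ord (leqnSn K) k)) (fun k => fi _).
rewrite (_ : (fun t => _) =
    (fun t => \sum_(k < K) f (widen_ord (leqnSn K) k) t + f ord_max t)).
  split; first exact: (integrableD mD gi (fi ord_max)).
  by rewrite RintegralD// big_ord_recr ige.
by apply/funext => t; rewrite big_ord_recr.
Qed.

(** Every relation of the theorem is an instance: as soon as a combination of
    kernels equals Q w = (P w)' pointwise, the same combination of their
    integrals is the increment of P w over [0, 1], which is 0.  The kernels on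
    the left may have another number L of linear factors than w. *)
Lemma eulerKernel_contiguity (R : realType) (M K L : nat) (a b : R)
    (x r : 'I_M -> R) (co a' b' : 'I_K -> R) (x' r' : 'I_K -> 'I_L -> R) :
  (forall i, x i < 1) -> 0 < a -> 0 < b ->
  (forall k i, x' k i < 1) -> (forall k, 0 < a' k) -> (forall k, 0 < b' k) ->
  (forall t, t \in `]0, 1[ ->
    \sum_(k < K) co k * eulerKernel (a' k) (b' k) (x' k) (r' k) t =
    eulerKernel a b x r t * pearsonQ a b x r t) ->
  \sum_(k < K) co k * \int[@lebesgue_measure R]_(t in `]0, 1[)
    eulerKernel (a' k) (b' k) (x' k) (r' k) t = 0.
Proof.
move=> x1 a0 b0 x1' a0' b0' h.
(* W is P w, see eulerKernel_pearsonP. *)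
pose W := eulerKernel (a + 1) (b + 1) x (fun i => r i + 1).
pose f k (t : R) : R := co k * eulerKernel (a' k) (b' k) (x' k) (r' k) t.
have fi k : (@lebesgue_measure R).-integrable `]0, 1[ (EFin \o f k).
  have := integrable_eulerKernel (r' k) (x1' k) (a0' k) (b0' k).
  exact: (@integrableZl _ _ R (@lebesgue_measure R) _ (measurable_itv _)).
have [sfi sfE] := @Rintegral_sum _ _ R (@lebesgue_measure R) _ _ _
  (measurable_itv _) fi.
transitivity (W 1 - W 0); last first.
  by rewrite /W /eulerKernel subrr !addrK !powR0 ?gt_eqF// mulr0 !mul0r subrr.
have <- : \int[@lebesgue_measure R]_(t in `]0, 1[) (\sum_(k < K) f k t) =
    W 1 - W 0; last first.
  rewrite sfE; apply: eq_bigr => k _; rewrite -RintegralZl//.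
  exact: integrable_eulerKernel.
apply: (integral_derivative_open (F := W) ltr01) => //.
- move=> t t01; have df k := is_deriveZ (co k)
    (is_derive_eulerKernel (a' k) (b' k) (r' k) (x1' k) t01).
  have := is_derive1_continuous (is_derive_sum df).
  have -> // : \sum_(k < K) co k *: eulerKernel (a' k) (b' k) (x' k) (r' k) =
    fun t => \sum_(k < K) f k t.
  by apply/funext => u; rewrite fct_sumE.
- move=> t t01; rewrite h// -pearsonP_logder// mulrA -eulerKernel_pearsonP//.
  apply: is_derive_eq (is_derive_eulerKernel _ _ _ x1 t01) _.
  by rewrite !addrK.
- by apply: within_continuous_eulerKernel; rewrite // ltrDr.
Qed.

(** * The generating function of the elementary symmetric polynomials *)

(** The homogeneous form serves both expansions: s = 1, u = - t for the powers
    of t, and u = 1 for the powers of s. *)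
Lemma prod_linear_elemsym (R : realType) (ys : seq R) (s u : R) :
  \prod_(y <- ys) (s + y * u) =
  \sum_(k < (size ys).+1) elemsym k%:Z ys * (s ^+ (size ys - k) * u ^+ k).
Proof.
rewrite (big_nth 0) big_mkord.
under eq_bigr do rewrite addrC.
rewrite bigA_distr/=.
(* Choosing a term from each factor selects a set A; its size is the degree. *)
rewrite (partition_big (fun A : {set 'I_(size ys)} => inord #|A| : 'I_(size ys).+1)
  predT)//=.
apply: eq_bigr => k _; rewrite mulr_suml.
have card_le (A : {set 'I_(size ys)}) : (#|A| <= size ys)%N.
  by rewrite -[leqRHS]card_ord max_card.
apply: eq_big => [A|A Ak].
  by rewrite -val_eqE /= inordK // ltnS.
move/eqP/(congr1 val): Ak; rewrite /= inordK ?ltnS // => Ak.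
rewrite (bigID (mem A))/=.
under eq_bigr => i iA do rewrite iA.
rewrite big_split/= -mulrA; congr (_ * _).
rewrite prodr_const (eq_bigr (fun=> s)); last by move=> i /negbTE ->.
rewrite prodr_const Ak mulrC; congr (_ ^+ _ * _).
have := cardC A; rewrite card_ord Ak => /(canRL (addKn _)) <-.
exact: eq_card.
Qed.

Lemma elemsym_gt_size (R : realType) (m : nat) (ys : seq R) :
  (size ys < m)%N -> elemsym m%:Z ys = 0.
Proof.
move=> hm; apply: big_pred0 => A; apply/negbTE; rewrite neq_ltn.
by rewrite (leq_ltn_trans _ hm)// -[leqRHS]card_ord max_card.
Qed.

(** Multiplication of a generating function by its variable.  The coefficients
    are indexed by integers, so the shifted sum has a term F (-1). *)
Lemma sum_shift (R : realType) (F : int -> R) (t : R) (K : nat) :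
  F (-1) = 0 ->
  \sum_(k < K.+1) F (k%:Z - 1) * t ^+ k = t * \sum_(k < K) F k%:Z * t ^+ k.
Proof.
move=> F0; rewrite big_ord_recl sub0r F0 mul0r add0r mulr_sumr.
apply: eq_bigr => k _; rewrite lift0 exprS mulrCA; congr (_ * (F _ * _)).
by rewrite -addn1 PoszD addrK.
Qed.

(** The sum may run beyond the degree of the product: the degrees of the extra
    terms are negative, and elemsym vanishes there.  Likewise below, where the
    degrees of the extra terms exceed the number of variables. *)
Lemma prod_addr_elemsym (R : realType) (ys : seq R) (K : nat) (s : R) :
  (size ys < K)%N ->
  \sum_(k < K) elemsym ((size ys)%:Z - k%:Z) ys * s ^+ k = \prod_(y <- ys) (s + y).
Proof.
move=> hK; transitivity (\prod_(y <- ys) (s + y * 1)); last first.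
  by apply: eq_bigr => y _; rewrite mulr1.
rewrite prod_linear_elemsym; symmetry.
rewrite (reindex_inj rev_ord_inj)/=.
rewrite (big_ord_widen _ (fun k => elemsym (((size ys).+1 - k.+1)%N)%:Z ys *
  (s ^+ (size ys - ((size ys).+1 - k.+1)) * 1 ^+ ((size ys).+1 - k.+1))) hK).
rewrite big_mkcond; apply: eq_bigr => k _; case: ifP => hk.
  by rewrite subSS subzn// subKn// expr1n mulr1.
have -> : (size ys)%:Z - k%:Z = - ((k - size ys)%N%:Z).
  by rewrite -subzn 1?opprB//; move: hk; lia.
by case: (k - size ys)%N (subn_gt0 (size ys) k) => [|m _]; [lia|rewrite mul0r].
Qed.

Lemma prod_onem_elemsym (R : realType) (ys : seq R) (K : nat) (t : R) :
  (size ys < K)%N ->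
  \sum_(k < K) (-1) ^ k%:Z * elemsym k%:Z ys * t ^+ k =
  \prod_(y <- ys) (1 - y * t).
Proof.
move=> hK; transitivity (\prod_(y <- ys) (1 + y * - t)); last first.
  by apply: eq_bigr => y _; rewrite mulrN.
rewrite prod_linear_elemsym; symmetry.
rewrite (big_ord_widen _ (fun k => elemsym k%:Z ys *
  (1 ^+ (size ys - k) * (- t) ^+ k)) hK).
rewrite big_mkcond; apply: eq_bigr => k _; case: ifP => hk.
  rewrite expr1n mul1r -exprnP [in LHS]exprNn; ring.
by rewrite elemsym_gt_size ?mulr0 ?mul0r//; lia.
Qed.

(** * Expansion of P and Q in the powers of t *)

Lemma signz_succ (R : realType) (k : nat) :
  (-1) ^ (k%:Z + 1) = - (-1) ^ k%:Z :> R.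
Proof. by rewrite -PoszD addn1 -!exprnP exprS mulN1r. Qed.

Lemma sum_sign_elemsym_pred (R : realType) (ys : seq R) (K : nat) (t : R) :
  (size ys < K)%N ->
  \sum_(k < K.+1) (-1) ^ k%:Z * elemsym (k%:Z - 1) ys * t ^+ k =
  - t * \prod_(y <- ys) (1 - y * t).
Proof.
move=> hK; have := sum_shift (F := fun m => (-1) ^ (m + 1) * elemsym m ys) t K.
rewrite /= mulr0 => /(_ erefl) h.
under [LHS]eq_bigr => k _ do rewrite -{1}(subrK 1 k%:Z).
rewrite {}h -(prod_onem_elemsym t hK) mulNr -mulrN -sumrN; congr (_ * _).
by apply: eq_bigr => k _; rewrite signz_succ !mulNr.
Qed.

Lemma sum_sign_elemsym_pair (R : realType) (ys : seq R) (K : nat) (t : R) :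
  (size ys < K)%N ->
  \sum_(k < K.+1) (-1) ^ k%:Z * (elemsym k%:Z ys + elemsym (k%:Z - 1) ys) * t ^+ k =
  (1 - t) * \prod_(y <- ys) (1 - y * t).
Proof.
move=> hK; under [LHS]eq_bigr do rewrite mulrDr mulrDl.
rewrite big_split/= prod_onem_elemsym 1?ltnW// sum_sign_elemsym_pred//; ring.
Qed.

Lemma sum_sign_elemsym_pair_pred (R : realType) (ys : seq R) (K : nat) (t : R) :
  (size ys < K)%N ->
  \sum_(k < K.+2) (-1) ^ k%:Z *
    (elemsym (k%:Z - 1) ys + elemsym (k%:Z - 2) ys) * t ^+ k =
  - (t * (1 - t) * \prod_(y <- ys) (1 - y * t)).
Proof.
move=> hK.
have := sum_shift
  (F := fun m => (-1) ^ (m + 1) * (elemsym m ys + elemsym (m - 1) ys)) t K.+1.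
rewrite /= addr0 mulr0 => /(_ erefl) h.
under [LHS]eq_bigr => k _ do rewrite -{1}(subrK 1 k%:Z).
transitivity (\sum_(k < K.+2) (-1) ^ (k%:Z - 1 + 1) *
  (elemsym (k%:Z - 1) ys + elemsym (k%:Z - 1 - 1) ys) * t ^+ k).
  by apply: eq_bigr => k _; rewrite -[k%:Z - 1 - 1]addrA -opprD.
rewrite {}h -mulrA -(sum_sign_elemsym_pair t hK) -mulrN -sumrN; congr (_ * _).
by apply: eq_bigr => k _; rewrite signz_succ !mulNr.
Qed.

Lemma prod_omit (R : realType) (N : nat) (ys : N.-tuple R) (l : 'I_N)
    (f : R -> R) :
  \prod_(y <- omit ys l) f y = \prod_(j < N | j != l) f (tnth ys j).
Proof. by rewrite /omit big_map big_filter big_enum_cond. Qed.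

Lemma size_omit (R : realType) (N : nat) (ys : N.-tuple R) (l : 'I_N) :
  size (omit ys l) = N.-1.
Proof.
rewrite /omit size_map size_filter -sum1_count big_enum_cond/= sum1_card.
by have := cardC1 l; rewrite card_ord => <-; apply: eq_card.
Qed.

Lemma prod_tuple (R : realType) (N : nat) (ys : N.-tuple R) (f : R -> R) :
  \prod_(y <- ys) f y = \prod_(j < N) f (tnth ys j).
Proof. by rewrite big_tuple. Qed.

(** The left side is P / t, because d_0 = 0. *)
Lemma sum_dcoef (R : realType) (N : nat) (x : N.-tuple R) (t : R) :
  \sum_(k < N.+2) dcoef x (k%:Z + 1) * t ^+ k =
  (1 - t) * \prod_(j < N) (1 - tnth x j * t).
Proof.
rewrite -(prod_tuple x (fun y => 1 - y * t)).
have hK : (size x < N.+1)%N by rewrite size_tuple.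
rewrite -(sum_sign_elemsym_pair t hK); apply: eq_bigr => k _.
by rewrite /dcoef addrK -[k%:Z + 1 - 2]addrA.
Qed.

Lemma sum_ecoef (R : realType) (N : nat) (beta1 beta2 : R)
    (alpha x : N.-tuple R) (t : R) :
  \sum_(k < N.+2) ecoef beta1 beta2 alpha x k%:Z * t ^+ k =
  pearsonQ (beta1 + 1) (beta2 + 1) (tnth x) (tnth alpha) t.
Proof.
have hK : (size x < N.+1)%N by rewrite size_tuple.
rewrite /pearsonQ -(prod_tuple x (fun y => 1 - y * t)).
rewrite -(sum_sign_elemsym_pair t hK).
have -> : t * \prod_(y <- x) (1 - y * t) =
    - \sum_(k < N.+2) (-1) ^ k%:Z * elemsym (k%:Z - 1) x * t ^+ k.
  by rewrite (sum_sign_elemsym_pred t hK) mulNr opprK.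
rewrite mulrN opprK.
rewrite !mulr_sumr -sumrN.
transitivity (\sum_(k < N.+2) ((beta1 + 1) * vcoef x k%:Z * t ^+ k +
    (beta2 + 1) * wcoef x k%:Z * t ^+ k +
    \sum_(l < N) (tnth alpha l + 1) * tnth x l * (zcoef x k%:Z l * t ^+ k))).
  apply: eq_bigr => k _; rewrite /ecoef.
  rewrite [LHS]mulrDl [X in X + _]mulrDl mulr_suml; congr (_ + _).
  by apply: eq_bigr => l _; rewrite mulrA.
rewrite !big_split/= exchange_big/=; congr (_ + _ + _).
- by apply: eq_bigr => k _; rewrite -mulrA.
- by apply: eq_bigr => k _; rewrite -mulrA.
apply: eq_bigr => l _; rewrite -mulr_sumr -mulrN; congr (_ * _).
have hl : (size (omit x l) < N)%N.
  by rewrite size_omit; case: N l {x alpha hK} => [[]|].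
by rewrite -(prod_omit x l (fun y => 1 - y * t)) -(sum_sign_elemsym_pair_pred t hl).
Qed.

(** * Expansion of P and Q in the powers of 1 - p t *)

Lemma sum_elemsym_rev (R : realType) (ys : seq R) (m K : nat) (s : R) :
  size ys = m -> (m < K)%N ->
  \sum_(k < K) elemsym (m%:Z - k%:Z) ys * s ^+ k = \prod_(y <- ys) (s + y).
Proof. by move=> <- hK; exact: prod_addr_elemsym. Qed.

(** With s = 1 - p t, the linear factors of Q are s + y with y in shifted x p,
    up to constants; moreover p t = 1 - s and p (1 - t) = s + (p - 1). *)
Lemma shifted_factor (R : realType) (N : nat) (x : N.-tuple R) (p t : R)
    (j : 'I_N) :
  tnth x j != 0 ->
  1 - p * t + tnth (shifted x p) j = p / tnth x j * (1 - tnth x j * t).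
Proof. by move=> xj; rewrite tnth_mktuple; field. Qed.

Lemma prod_shifted (R : realType) (N : nat) (x : N.-tuple R) (p t : R) :
  (forall j, tnth x j != 0) ->
  \prod_(y <- shifted x p) (1 - p * t + y) =
  p ^+ N / \prod_(j < N) tnth x j * \prod_(j < N) (1 - tnth x j * t).
Proof.
move=> x0; rewrite (prod_tuple (shifted x p)).
rewrite -prodfV -[in p ^+ N](card_ord N) -prodr_const -!big_split/=.
by apply: eq_bigr => j _; exact: shifted_factor.
Qed.

Lemma prod_omit_shifted (R : realType) (N : nat) (x : N.-tuple R) (p t : R)
    (l : 'I_N) :
  p != 0 -> (forall j, tnth x j != 0) ->
  \prod_(y <- omit (shifted x p) l) (1 - p * t + y) =
  tnth x l / p * (p ^+ N / \prod_(j < N) tnth x j *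
   \prod_(j < N | j != l) (1 - tnth x j * t)).
Proof.
move=> p0 x0; rewrite (prod_omit (shifted x p) l).
have -> : p ^+ N / \prod_(j < N) tnth x j =
    p / tnth x l * \prod_(j < N | j != l) (p / tnth x j).
  rewrite -prodfV -[in p ^+ N](card_ord N) -prodr_const -big_split/=.
  by rewrite (bigD1 l).
rewrite -[p / _ * _ * _]mulrA -big_split/= mulrA.
rewrite (_ : _ / p * _ = 1) ?mul1r; last first.
  by field; rewrite p0 x0.
by apply: eq_bigr => j _; exact: shifted_factor.
Qed.

Lemma sum_dcoefp (R : realType) (N : nat) (x : N.-tuple R) (p t : R) :
  p != 0 -> (forall j, tnth x j != 0) ->
  \sum_(k < N.+3) dcoefp x p k%:Z * (1 - p * t) ^+ k = pearsonP (tnth x) t.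
Proof.
move=> p0 x0; set s := 1 - p * t.
have X0 : \prod_(j < N) tnth x j != 0 by apply/prodf_neq0 => j _; exact: x0.
pose ys : seq R := (p - 1) :: shifted x p.
have sys : size ys = N.+1 by congr _.+1; exact: size_tuple.
have e1 : \sum_(k < N.+3) elemsym (N%:Z + 1 - k%:Z) ys * s ^+ k =
    \prod_(y <- ys) (s + y).
  rewrite -(@sum_elemsym_rev _ _ N.+1 N.+3)//.
  by apply: eq_bigr => k _; rewrite -PoszD addn1.
have e2 : \sum_(k < N.+3) elemsym (N%:Z + 2 - k%:Z) ys * s ^+ k =
    s * \prod_(y <- ys) (s + y).
  rewrite -(@sum_elemsym_rev _ _ N.+1 N.+2)//.
  rewrite -(sum_shift (F := fun m => elemsym (N.+1%:Z - m) ys)).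
    by apply: eq_bigr => k _; congr (elemsym _ _ * _); lia.
  by rewrite opprK -PoszD addn1 elemsym_gt_size ?sys.
transitivity ((\prod_(j < N) tnth x j) / p ^+ (N + 2) *
  (\prod_(y <- ys) (s + y) - s * \prod_(y <- ys) (s + y))).
  rewrite -e2 -e1 -sumrB mulr_sumr; apply: eq_bigr => k _.
  by rewrite /dcoefp -/ys; ring.
rewrite /ys big_cons prod_shifted// /pearsonP /s exprD.
have q0 : p ^+ N != 0 by rewrite expf_neq0.
by field; rewrite ?p0 ?X0 ?q0.
Qed.

Lemma sum_ecoefp (R : realType) (N : nat) (beta1 beta2 : R)
    (alpha x : N.-tuple R) (p t : R) :
  p != 0 -> (forall j, tnth x j != 0) ->
  \sum_(k < N.+2) ecoefp beta1 beta2 alpha x p k%:Z * (1 - p * t) ^+ k =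
  pearsonQ (beta1 + 1) (beta2 + 1) (tnth x) (tnth alpha) t.
Proof.
move=> p0 x0; set s := 1 - p * t.
have X0 : \prod_(j < N) tnth x j != 0 by apply/prodf_neq0 => j _; exact: x0.
have e (ys : seq R) : size ys = N.+1 ->
    \sum_(k < N.+2) elemsym (N%:Z + 1 - k%:Z) ys * s ^+ k =
    \prod_(y <- ys) (s + y).
  move=> sys; rewrite -(@sum_elemsym_rev _ _ N.+1 N.+2)//.
  by apply: eq_bigr => k _; rewrite -PoszD addn1.
pose C := (\prod_(j < N) tnth x j) / p ^+ (N + 1).
transitivity (C * ((beta1 + 1) * \sum_(k < N.+2) vcoefp x p k%:Z * s ^+ k +
  (beta2 + 1) * \sum_(k < N.+2) wcoefp x p k%:Z * s ^+ k +
  \sum_(l < N) (tnth alpha l + 1) * \sum_(k < N.+2) zcoefp x p k%:Z l * s ^+ k)).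
  rewrite [X in _ = _ * (_ + X)](eq_bigr (fun l => \sum_(k < N.+2)
    (tnth alpha l + 1) * (zcoefp x p k%:Z l * s ^+ k))); last first.
    by move=> l _; rewrite mulr_sumr.
  rewrite exchange_big/= ![_ * \sum_(k < N.+2) _]mulr_sumr -!big_split/= mulr_sumr.
  apply: eq_bigr => k _; rewrite /ecoefp -/C -[C * _ * _]mulrA; congr (_ * _).
  rewrite [LHS]mulrDl [X in X + _]mulrDl mulr_suml !mulrA; congr (_ + _).
  by apply: eq_bigr => l _; rewrite mulrA.
have sz : size (shifted x p) = N by exact: size_tuple.
rewrite !e; [|by congr _.+1|by congr _.+1].
rewrite !big_cons prod_shifted//.
have q0 : p ^+ N != 0 by rewrite expf_neq0.
rewrite /pearsonQ !mulrDr mulr_sumr -sumrN; congr (_ + _ + _).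
- by rewrite /C /s exprD; field; rewrite ?p0 ?X0 ?q0.
- by rewrite /C /s exprD; field; rewrite ?p0 ?X0 ?q0.
apply: eq_bigr => l _; rewrite e; last first.
  by rewrite /= size_omit prednK// (leq_ltn_trans _ (ltn_ord l)).
rewrite !big_cons prod_omit_shifted// /C /s exprD.
by field; rewrite ?p0 ?X0 ?q0.
Qed.

(** The coefficient d_0 is the value of P at s = 0, that is, at t = 1 / p. *)
Lemma dcoefp0 (R : realType) (N : nat) (x : N.-tuple R) (p : R) :
  p != 0 -> (forall j, tnth x j != 0) -> pearsonP (tnth x) p^-1 = 0 ->
  dcoefp x p 0 = 0.
Proof.
move=> p0 x0; rewrite -(sum_dcoefp _ p0 x0) divff// subrr big_ord_recl expr0 mulr1.
rewrite big1 ?addr0// => k _.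
by rewrite lift0 expr0n mulr0.
Qed.

Lemma sum_dcoefp_succ (R : realType) (N : nat) (x : N.-tuple R) (p t : R) :
  p != 0 -> (forall j, tnth x j != 0) -> pearsonP (tnth x) p^-1 = 0 ->
  (1 - p * t) * \sum_(k < N.+2) dcoefp x p (k%:Z + 1) * (1 - p * t) ^+ k =
  pearsonP (tnth x) t.
Proof.
move=> p0 x0 hp; rewrite -(sum_dcoefp t p0 x0) [RHS]big_ord_recl.
rewrite (_ : dcoefp _ _ _ = 0) ?mul0r ?add0r; last exact: dcoefp0.
rewrite mulr_sumr; apply: eq_bigr => k _.
by rewrite lift0 exprS mulrCA -PoszD addn1.
Qed.

(** * Kernels and Q under a change of parameters *)

Lemma lauricellaFD_eulerKernel (R : realType) (M : nat) (a c : R)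
    (b x : M.-tuple R) :
  lauricellaFD a b c x = (eulerBeta a (c - a))^-1 *
    \int[@lebesgue_measure R]_(t in `]0, 1[)
      eulerKernel a (c - a) (tnth x) (fun i => - tnth b i) t.
Proof. by []. Qed.

Lemma eulerBeta_lauricellaFD (R : realType) (M : nat) (a d c : R)
    (b x : M.-tuple R) : 0 < a -> 0 < d -> c - a = d ->
  eulerBeta a d * lauricellaFD a b c x =
    \int[@lebesgue_measure R]_(t in `]0, 1[)
      eulerKernel a d (tnth x) (fun i => - tnth b i) t.
Proof.
move=> a0 d0 cad; rewrite lauricellaFD_eulerKernel cad mulVKf//.
exact: eulerBeta_neq0.
Qed.

Lemma powR_addn (R : realType) (u e : R) (k : nat) : 0 < u ->
  u `^ (e + k%:R) = u `^ e * u ^+ k.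
Proof.
move=> u0; rewrite powRD ?(gt_eqF u0) ?implybT//.
by rewrite powR_mulrn// ltW.
Qed.

Lemma eulerKernel_addl (R : realType) (M : nat) (a b : R) (x r : 'I_M -> R)
    (k : nat) (t : R) : t \in `]0, 1[ ->
  eulerKernel (a + k%:R) b x r t = eulerKernel a b x r t * t ^+ k.
Proof.
rewrite in_itv/= => /andP[t0 _]; rewrite /eulerKernel.
by rewrite [a + _ - 1]addrAC powR_addn//; ring.
Qed.

Lemma eulerKernel_addr (R : realType) (M : nat) (a b : R) (x r : 'I_M -> R)
    (k : nat) (t : R) : t \in `]0, 1[ ->
  eulerKernel a (b + k%:R) x r t = eulerKernel a b x r t * (1 - t) ^+ k.
Proof.
rewrite in_itv/= => /andP[_ t1]; rewrite /eulerKernel.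
by rewrite [b + _ - 1]addrAC powR_addn ?subr_gt0//; ring.
Qed.

Lemma eulerKernel_add_exponent (R : realType) (M : nat) (a b : R)
    (x r r' : 'I_M -> R) (i : 'I_M) (k : nat) (t : R) :
  x i < 1 -> t \in `]0, 1[ ->
  (forall j, r' j = if j == i then r j + k%:R else r j) ->
  eulerKernel a b x r' t = eulerKernel a b x r t * (1 - x i * t) ^+ k.
Proof.
rewrite in_itv/= => xi /andP[t0 t1] r'E; rewrite /eulerKernel.
rewrite (bigD1 i)//= [in RHS](bigD1 i)//= r'E eqxx powR_addn; last first.
  by rewrite linear_factor_gt0// !ltW.
under eq_bigr => j /negbTE ji do rewrite r'E ji.
ring.
Qed.

(** The correction is n s' P / s for s = 1 - x_i t. *)
Lemma pearsonQ_add_exponent (R : realType) (M : nat) (a b n : R)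
    (x r r' : 'I_M -> R) (i : 'I_M) (t : R) :
  (forall j, r' j = if j == i then r j + n else r j) ->
  pearsonQ a b x r' t = pearsonQ a b x r t -
    n * x i * (t * (1 - t) * \prod_(j < M | j != i) (1 - x j * t)).
Proof.
move=> r'E; rewrite /pearsonQ [X in _ - X = _](bigD1 i)//=.
rewrite [X in _ = _ - X - _](bigD1 i)//= r'E eqxx.
rewrite [X in _ - (_ + X) = _](eq_bigr (fun l => (r l + 1) * x l *
    (t * (1 - t) * \prod_(j < M | j != l) (1 - x j * t)))); last first.
  by move=> j /negbTE ji; rewrite r'E ji.
ring.
Qed.

Lemma tnth_rcons_widen (T : Type) (M : nat) (x : M.-tuple T) (p : T) (i : 'I_M) :
  tnth [tuple of rcons x p] (widen_ord (leqnSn M) i) = tnth x i.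
Proof. by rewrite !(tnth_nth p)/= nth_rcons size_tuple ltn_ord. Qed.

Lemma tnth_rcons_max (T : Type) (M : nat) (x : M.-tuple T) (p : T) :
  tnth [tuple of rcons x p] ord_max = p.
Proof. by rewrite (tnth_nth p)/= nth_rcons size_tuple ltnn eqxx. Qed.

Lemma eulerKernel_rcons (R : realType) (M : nat) (a b : R)
    (x e : M.-tuple R) (p q : R) (t : R) :
  eulerKernel a b (tnth [tuple of rcons x p])
    (fun i => - tnth [tuple of rcons e q] i) t =
  eulerKernel a b (tnth x) (fun i => - tnth e i) t * (1 - p * t) `^ (- q).
Proof.
rewrite /eulerKernel big_ord_recr/= !tnth_rcons_max mulrA; congr (_ * _ * _).
by apply: eq_bigr => i _; rewrite !tnth_rcons_widen.
Qed.

(** Under w := w s `^ (- q), with s = 1 - p t, the polynomial P becomes P s, and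
    (P s w s `^ (- q))' = (s Q - (1 - q) p P) w s `^ (- q). *)
Lemma pearsonQ_rcons (R : realType) (M : nat) (a b : R)
    (x e : M.-tuple R) (p q : R) (t : R) :
  pearsonQ a b (tnth [tuple of rcons x p])
    (fun i => - tnth [tuple of rcons e q] i) t =
  (1 - p * t) * pearsonQ a b (tnth x) (fun i => - tnth e i) t -
  (1 - q) * p * pearsonP (tnth x) t.
Proof.
set xp := [tuple of rcons x p].
have pr : \prod_(i < M.+1) (1 - tnth xp i * t) =
    (\prod_(i < M) (1 - tnth x i * t)) * (1 - p * t).
  rewrite big_ord_recr/= tnth_rcons_max; congr (_ * _).
  by apply: eq_bigr => i _; rewrite tnth_rcons_widen.
have pl (l : 'I_M) :
    \prod_(j < M.+1 | j != widen_ord (leqnSn M) l) (1 - tnth xp j * t) =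
    (\prod_(j < M | j != l) (1 - tnth x j * t)) * (1 - p * t).
  rewrite big_mkcond big_ord_recr/= tnth_rcons_max.
  rewrite [_ == _](_ : _ = false)/=; last first.
    by apply/negbTE; rewrite neq_ltn/= ltn_ord orbT.
  congr (_ * _); rewrite [RHS]big_mkcond; apply: eq_bigr => i _.
  by rewrite tnth_rcons_widen.
have pm : \prod_(j < M.+1 | j != ord_max) (1 - tnth xp j * t) =
    \prod_(j < M) (1 - tnth x j * t).
  rewrite big_mkcond big_ord_recr/= eqxx mulr1; apply: eq_bigr => i _.
  rewrite tnth_rcons_widen ifT//.
  by rewrite neq_ltn/= ltn_ord.
rewrite /pearsonQ /pearsonP pr [X in _ - X = _]big_ord_recr/= pm !tnth_rcons_max.
rewrite [X in _ - (X + _) = _](eq_bigr (fun l => (1 - p * t) *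
    ((- tnth e l + 1) * tnth x l *
     (t * (1 - t) * \prod_(j < M | j != l) (1 - tnth x j * t))))); last first.
  by move=> l _; rewrite pl !tnth_rcons_widen; ring.
rewrite -mulr_sumr; ring.
Qed.

(** * The four contiguity relations *)

(** The kernels s^k w share the factor w, so that the pointwise hypothesis of
    the contiguity principle reduces to a polynomial expansion. *)
Lemma factor_kernel (R : realType) (K : nat) (k0 s Q : R) (co f : nat -> R) :
  (forall k, f k = k0 * s ^+ k) ->
  \sum_(k < K) co k * s ^+ k = Q ->
  \sum_(k < K) co k * f k = k0 * Q.
Proof.
move=> fE <-; rewrite mulr_sumr; apply: eq_bigr => k _.
by rewrite fE mulrCA.
Qed.

Lemma sum_dcoef_ecoef (R : realType) (N : nat) (n beta1 beta2 : R)
    (alpha x : N.-tuple R) (t : R) :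
  \sum_(k < N.+2) (n * dcoef x (k%:Z + 1) + ecoef beta1 beta2 alpha x k%:Z)
    * t ^+ k =
  n * ((1 - t) * \prod_(j < N) (1 - tnth x j * t)) +
  pearsonQ (beta1 + 1) (beta2 + 1) (tnth x) (tnth alpha) t.
Proof.
rewrite -sum_dcoef -sum_ecoef mulr_sumr -big_split; apply: eq_bigr => k _ /=.
by rewrite mulrDl mulrA.
Qed.

Lemma sum_dcoefp_ecoefp (R : realType) (N : nat) (n beta1 beta2 : R)
    (alpha x : N.-tuple R) (p t : R) :
  p != 0 -> (forall j, tnth x j != 0) ->
  1 - p * t != 0 -> pearsonP (tnth x) p^-1 = 0 ->
  \sum_(k < N.+2) (- n * p * dcoefp x p (k%:Z + 1)
      + ecoefp beta1 beta2 alpha x p k%:Z) * (1 - p * t) ^+ k =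
  - n * p * (pearsonP (tnth x) t / (1 - p * t)) +
  pearsonQ (beta1 + 1) (beta2 + 1) (tnth x) (tnth alpha) t.
Proof.
move=> p0 x0 s0 hp; rewrite -(sum_dcoefp_succ t p0 x0 hp).
rewrite [(1 - p * t) * _]mulrC mulfK//.
rewrite -(sum_ecoefp _ _ _ t p0 x0) mulr_sumr -big_split; apply: eq_bigr => k _ /=.
by rewrite mulrDl !mulrA.
Qed.

(** All symmetric polynomials in e_(-1)(p) have degree N + 2 in N + 1
    variables. *)
Lemma ecoefp_pred0 (R : realType) (N : nat) (beta1 beta2 : R)
    (alpha x : N.-tuple R) (p : R) :
  ecoefp beta1 beta2 alpha x p (-1) = 0.
Proof.
have v0 (ys : seq R) : size ys = N.+1 -> elemsym (N%:Z + 1 - -1) ys = 0.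
  by move=> sys; rewrite opprK -!PoszD elemsym_gt_size// sys; lia.
rewrite /ecoefp /vcoefp /wcoefp !v0; first last.
  by congr _.+1; exact: size_tuple.
  by congr _.+1; exact: size_tuple.
rewrite [X in _ * (_ + X)]big1 ?mulr0 ?addr0 ?mulr0// => l _.
rewrite /zcoefp v0 ?mulr0//=.
by rewrite size_omit prednK// (leq_ltn_trans _ (ltn_ord l)).
Qed.

Lemma sum_dcoefp_ecoefp_pred (R : realType) (N : nat) (n beta1 beta2 : R)
    (alpha x : N.-tuple R) (p t : R) :
  p != 0 -> (forall j, tnth x j != 0) ->
  \sum_(k < N.+3) (- n * p * dcoefp x p k%:Z
      + ecoefp beta1 beta2 alpha x p (k%:Z - 1)) * (1 - p * t) ^+ k =
  - n * p * pearsonP (tnth x) t +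
  (1 - p * t) * pearsonQ (beta1 + 1) (beta2 + 1) (tnth x) (tnth alpha) t.
Proof.
move=> p0 x0; rewrite -(sum_dcoefp t p0 x0) -(sum_ecoefp _ _ _ t p0 x0).
rewrite -(sum_shift (F := ecoefp beta1 beta2 alpha x p)) ?ecoefp_pred0//.
rewrite mulr_sumr -big_split; apply: eq_bigr => k _ /=.
by rewrite mulrDl !mulrA.
Qed.

Theorem theorem3p2 (R : realType) (N : nat) (hN : (1 <= N)%N)
    (a c : R) (b x : N.-tuple R) (hx : forall i : 'I_N, tnth x i < 1) :
  let beta1 := a - 1 in
  let beta2 := c - a - 1 in
  let alpha := [tuple - tnth b i | i < N] in
  [/\ (forall n : int, 0 <= n -> 0 < a -> a < c ->
        \sum_(k < N.+2)
          (n%:~R * dcoef x (k%:Z + 1) + ecoef beta1 beta2 alpha x k%:Z) *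
          eulerBeta (a + k%:R + n%:~R) (c - a) *
          lauricellaFD (a + k%:R + n%:~R) b (c + k%:R + n%:~R) x = 0),
      (forall (n : int) (p : R), n < 0 -> 0 < a -> a < c ->
        (forall j : 'I_N, tnth x j != 0) ->
        p < 1 -> p != 0 -> (forall j : 'I_N, p != tnth x j) ->
        \sum_(k < N.+3)
          (- n%:~R * p * dcoefp x p k%:Z
             + ecoefp beta1 beta2 alpha x p (k%:Z - 1)) *
          lauricellaFD a [tuple of rcons b (1 - k%:R - n%:~R)]
                       c [tuple of rcons x p] = 0),
      (forall (n : int) (p : R), 0 < a -> a < c + n%:~R ->
        (forall j : 'I_N, tnth x j != 0) ->
        p = 1 ->
        \sum_(k < N.+2)
          (- n%:~R * p * dcoefp x p (k%:Z + 1)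
             + ecoefp beta1 beta2 alpha x p k%:Z) *
          eulerBeta a (c + k%:R + n%:~R - a) *
          lauricellaFD a b (c + n%:~R + k%:R) x = 0)
    & (forall (n : int) (p : R) (i : 'I_N), 0 < a -> a < c ->
        (forall j : 'I_N, tnth x j != 0) ->
        p = tnth x i ->
        \sum_(k < N.+2)
          (- n%:~R * p * dcoefp x p (k%:Z + 1)
             + ecoefp beta1 beta2 alpha x p k%:Z) *
          lauricellaFD a
            [tuple if j == i then tnth b j - n%:~R - k%:R else tnth b j
              | j < N] c x = 0)].
Proof.
move=> beta1 beta2 alpha.
have alphaE : tnth alpha = fun i => - tnth b i.
  by apply/funext => i; rewrite tnth_mktuple.
have b1 : beta1 + 1 = a by rewrite /beta1 subrK.
have b2 : beta2 + 1 = c - a by rewrite /beta2 subrK.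
split.
(* The weight is multiplied by t^n, that is, a is raised by n. *)
- move=> n n0 a0 ac; have d0 : 0 < c - a by rewrite subr_gt0.
  have nR : 0 <= n%:~R :> R by rewrite ler0z.
  have an0 k : 0 < a + k%:R + n%:~R :> R.
    by rewrite -addrA ltr_wpDr// addr_ge0.
  pose r (i : 'I_N) := - tnth b i.
  pose co k := n%:~R * dcoef x (k%:Z + 1) + ecoef beta1 beta2 alpha x k%:Z.
  rewrite -[RHS](@eulerKernel_contiguity R N N.+2 N (a + n%:~R) (c - a) (tnth x) r
    (fun k => co k) (fun k => a + k%:R + n%:~R) (fun=> c - a) (fun=> tnth x)
    (fun=> r))//.
  + by apply: eq_bigr => k _; rewrite -mulrA eulerBeta_lauricellaFD//; ring.
  + by have := an0 0%N; rewrite addr0.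
  + move=> t t01.
    apply: (factor_kernel (s := t) (f := fun k =>
        eulerKernel (a + k%:R + n%:~R) (c - a) (tnth x) r t)).
      by move=> k; rewrite addrAC eulerKernel_addl.
    by rewrite sum_dcoef_ecoef b1 b2 alphaE /pearsonQ -/r; ring.
(* The weight is multiplied by (1 - p t)^(n - 1), not by the n-th power: as
   1 - p t does not divide P, the polynomial for the n-th power would have a
   pole at t = 1 / p. *)
- move=> n p n0 a0 ac x0 p1 p0 px; have d0 : 0 < c - a by rewrite subr_gt0.
  have xp1 (i : 'I_N.+1) : tnth [tuple of rcons x p] i < 1.
    rewrite (tnth_nth 0)/= nth_rcons size_tuple; case: ltngtP => // hi.
      by have := hx (Ordinal hi); rewrite (tnth_nth 0).
  pose r q (i : 'I_N.+1) := - tnth [tuple of rcons b q] i.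
  pose co k := - n%:~R * p * dcoefp x p k%:Z
             + ecoefp beta1 beta2 alpha x p (k%:Z - 1).
  transitivity ((eulerBeta a (c - a))^-1 * \sum_(k < N.+3) co k *
    \int[@lebesgue_measure R]_(t in `]0, 1[)
      eulerKernel a (c - a) (tnth [tuple of rcons x p])
        (r (1 - k%:R - n%:~R)) t).
    rewrite mulr_sumr; apply: eq_bigr => k _.
    by rewrite lauricellaFD_eulerKernel mulrCA.
  rewrite (@eulerKernel_contiguity R N.+1 N.+3 N.+1 a (c - a)
    (tnth [tuple of rcons x p]) (r (1 - n%:~R)) (fun k => co k) (fun=> a) (fun=> c - a)
    (fun=> tnth [tuple of rcons x p]) (fun k => r (1 - k%:R - n%:~R))) ?mulr0//.
  move=> t t01.
  apply: (factor_kernel (s := 1 - p * t) (f := fun k =>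
    eulerKernel a (c - a) (tnth [tuple of rcons x p]) (r (1 - k%:R - n%:~R)) t)).
    move=> k; rewrite !eulerKernel_rcons -mulrA -powR_addn; last first.
      move: t01; rewrite in_itv/= => /andP[t0 t1].
      by rewrite linear_factor_gt0// !ltW.
    by congr (_ * _ `^ _); ring.
  by rewrite sum_dcoefp_ecoefp_pred// b1 b2 alphaE pearsonQ_rcons; ring.
(* The weight is multiplied by (1 - t)^n, that is, c - a is raised by n. *)
- move=> n p a0 ac x0 ->; have d0 : 0 < c + n%:~R - a by rewrite subr_gt0.
  have dk0 k : 0 < c + k%:R + n%:~R - a.
    have -> : c + k%:R + n%:~R - a = c + n%:~R - a + k%:R by ring.
    by rewrite ltr_wpDr.
  pose r (i : 'I_N) := - tnth b i.
  pose co k := - n%:~R * 1 * dcoefp x 1 (k%:Z + 1)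
             + ecoefp beta1 beta2 alpha x 1 k%:Z.
  rewrite -[RHS](@eulerKernel_contiguity R N N.+2 N a (c + n%:~R - a) (tnth x) r
    (fun k => co k) (fun=> a) (fun k => c + k%:R + n%:~R - a) (fun=> tnth x)
    (fun=> r))//.
    by apply: eq_bigr => k _; rewrite -mulrA eulerBeta_lauricellaFD//; ring.
  move=> t t01.
  have s0 : 1 - 1 * t != 0.
    by move: t01; rewrite in_itv/= mul1r subr_eq0 => /andP[_ /gt_eqF ->].
  apply: (factor_kernel (s := 1 - 1 * t) (f := fun k =>
      eulerKernel a (c + k%:R + n%:~R - a) (tnth x) r t)).
    by move=> k; rewrite mul1r -eulerKernel_addr//; congr eulerKernel; ring.
  rewrite sum_dcoefp_ecoefp ?oner_neq0//; last first.
    by rewrite /pearsonP invr1 subrr mulr0 mul0r.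
  rewrite b1 b2 alphaE /pearsonQ -/r /pearsonP; field.
  by move: s0; rewrite mul1r.
(* The weight is multiplied by (1 - x_i t)^n, that is, b_i is lowered by n. *)
- move=> n p i a0 ac x0 ->; have d0 : 0 < c - a by rewrite subr_gt0.
  pose r q (j : 'I_N) := if j == i then - tnth b j + q else - tnth b j.
  pose co k := - n%:~R * tnth x i * dcoefp x (tnth x i) (k%:Z + 1)
             + ecoefp beta1 beta2 alpha x (tnth x i) k%:Z.
  transitivity ((eulerBeta a (c - a))^-1 * \sum_(k < N.+2) co k *
    \int[@lebesgue_measure R]_(t in `]0, 1[)
      eulerKernel a (c - a) (tnth x) (r (n%:~R + k%:R)) t).
    rewrite mulr_sumr; apply: eq_bigr => k _.
    rewrite lauricellaFD_eulerKernel mulrCA; congr (_ * (_ * _)).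
    apply: eq_Rintegral => t _; congr eulerKernel; apply/funext => j.
    by rewrite tnth_mktuple /r; case: ifP => // _; ring.
  rewrite (@eulerKernel_contiguity R N N.+2 N a (c - a) (tnth x) (r n%:~R)
    (fun k => co k) (fun=> a) (fun=> c - a) (fun=> tnth x)
    (fun k => r (n%:~R + k%:R))) ?mulr0//.
  move=> t t01.
  have s0 : 1 - tnth x i * t != 0.
    move: t01; rewrite in_itv/= => /andP[t0 t1].
    by rewrite gt_eqF// linear_factor_gt0// !ltW.
  apply: (factor_kernel (s := 1 - tnth x i * t) (f := fun k =>
      eulerKernel a (c - a) (tnth x) (r (n%:~R + k%:R)) t)).
    move=> k; apply: eulerKernel_add_exponent => // j.
    by rewrite /r; case: ifP => // _; rewrite addrA.
  rewrite sum_dcoefp_ecoefp//; last first.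
    by rewrite /pearsonP (bigD1 i)//= divff// subrr mul0r mulr0.
  rewrite b1 b2 alphaE
    [RHS](@pearsonQ_add_exponent _ _ _ _ n%:~R _ (fun j => - tnth b j) _ i)//.
  by rewrite /pearsonP (bigD1 i)//=; field.
Qed.
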